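(* Let $p$ be a prime, let $r,t,m\ge 1$ be integers, let $1\le h\le r$, and put $n:=4t(m-1)+1$. Let $H_1,\dots,H_n\le \mathbb{F}_p^r$ be subspaces, all of dimension $h$, which are $m$-generating. For $1\le j\le n$ let $x_{1,j},\dots,x_{r-h,j}\in\mathbb{F}_p^r$ be such that $\mathrm{span}_{\mathbb{F}_p}\{H_j,x_{1,j},\dots,x_{r-h,j}\}=\mathbb{F}_p^r$. Let $f:\mathbb{F}_p^r\to\mathbb{C}$, and write $\widehat f=\widehat g+\epsilon$, where $\widehat g,\epsilon:\widehat{\mathbb{F}_p^r}\to\mathbb{C}$ and the support of $\widehat g$ has at most $t$ elements. For $1\le j\le n$ and $x\in\mathbb{F}_p^r$ let $g_{j,x}:H_j\to\mathbb{C}$, $g_{j,x}(y)=f(x+y)$, and let $c_{j,x}:=F_j(g_{j,x})$, where $F_j$ is the Fourier transform for $H_j$, regarded as producing a function on $\widehat{\mathbb{F}_p^r}/H_j^\perp$. Consider the following algorithm. 1. Initialize $\widehat f'$, $\widehat f''$ and $Y$ as the zero functions on $\widehat{\mathbb{F}_p^r}$, and $Z$ as the empty list. 2. For each $j=1,\dots,n$, and for each of $2t-1$ cosets $C\in\widehat{\mathbb{F}_p^r}/H_j^\perp$ for which $|c_{j,0}(C)|$ is largest: (a) for each $1\le l\le r-h$, apply the one-frequency algorithm (described in the context) to the function $\overline f:\mathbb{F}_p\to\mathbb{C}$, $\overline f(a)=c_{j,a x_{l,j}}(C)$, obtaining $y_l\in\{0,\dots,p-1\}$ (equivalently, the coset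 of $(\mathrm{span}_{\mathbb{F}_p}\{x_{l,j}\})^\perp$ in $\widehat{\mathbb{F}_p^r}$ consisting of the characters $\chi$ with $\chi(ax_{l,j})=\omega_p^{a y_l}$ for all $a\in\mathbb{F}_p$); (b) let $\chi_w$ be the unique element of $C$ with $\chi_w(x_{l,j})=\omega_p^{y_l}$ for all $1\le l\le r-h$ (i.e. the unique element lying in $C$ and in all the cosets found in (a)); (c) set $Y(\chi_w):=Y(\chi_w)+1$; if then $Y(\chi_w)=2t(\lceil r/h\rceil-1)+1$, append $\chi_w$ to $Z$. 3. For each $\chi_w\in Z$: let $X$ be the list $(c_{1,0}(\chi_wH_1^\perp),\dots,c_{n,0}(\chi_wH_n^\perp))$ (with repetitions) and set $\widehat f''(\chi_w):=\mathrm{Median}(\mathrm{Re}(x):x\in X)+i\,\mathrm{Median}(\mathrm{Im}(x):x\in X)$. 4. For each of $t$ elements $\chi_w\in\widehat{\mathbb{F}_p^r}$ for which $|\widehat f''(\chi_w)|$ is largest, set $\widehat f'(\chi_w):=\widehat f''(\chi_w)$. 5. Return $\widehat f'$. Then the returned function $\widehat f'$ satisfies $|\mathrm{supp}(\widehat f')|\le t$ and $$\|\widehat f-\widehat f'\|_1\le(1+3\sqrt2)\,\|\epsilon\|_1 .$$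
   Context: Notation. $\omega_p=e^{2\pi i/p}$; for $y\in\mathbb{F}_p^r$, $\chi_y:\mathbb{F}_p^r\to\mathbb{C}$ is the character $\chi_y(x)=\omega_p^{x_1y_1+\dots+x_ry_r}$, and $\widehat{\mathbb{F}_p^r}=\{\chi_y:y\in\mathbb{F}_p^r\}$ is the dual group (with $\chi_y\chi_z=\chi_{y+z}$). For $f:\mathbb{F}_p^r\to\mathbb{C}$ the Fourier transform $\widehat f:\widehat{\mathbb{F}_p^r}\to\mathbb{C}$ is $\widehat f(\chi_y)=p^{-r}\sum_{x\in\mathbb{F}_p^r}f(x)\chi_y(x)^{-1}$, so that $f=\sum_{\chi_y}\widehat f(\chi_y)\chi_y$. $\|\cdot\|_1$ is the sum of absolute values over $\widehat{\mathbb{F}_p^r}$. Subspaces $H_1,\dots,H_n$ of $\mathbb{F}_p^r$ are called $m$-generating if $\mathrm{span}_{\mathbb{F}_p}\{H_{i_1},\dots,H_{i_m}\}=\mathbb{F}_p^r$ for all $1\le i_1<\dots<i_m\le n$. For a subspace $H\le\mathbb{F}_p^r$, $H^\perp:=\{\chi_y\in\widehat{\mathbb{F}_p^r}:\chi_y(x)=1\ \forall x\in H\}$. The dual group $\widehat H$ is identified with $\widehat{\mathbb{F}_p^r}/H^\perp$ via $\chi_yH^\perp\leftrightarrow\chi_y|_H$. Under this identification the Fourier transform for $H$ of $u:H\to\mathbb{C}$ is the function $\chi_yH^\perp\mapsto |H|^{-1}\sum_{x\in H}u(x)\chi_y(x)^{-1}$. One-frequency algorithm. For $d>0$ and $x\in\mathbb{R}$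 let $|x|_d:=\mathrm{dist}(x,d\mathbb{Z})$. Let $k\in\mathbb{Z}$ be minimal with $2^k\ge p/3$. Integers are identified with their images in $\mathbb{F}_p$ where needed. Given $u:\mathbb{F}_p\to\mathbb{C}$, set $b(2^l):=\arg(u(2^l)/u(0))$ for $0\le l\le k$ (and $b(2^l):=0$ if $u(2^l)=0$ or $u(0)=0$). The algorithm returns the index $j\in\{0,\dots,p-1\}$ such that $|p\,b(2^l)/(2\pi)-2^lj|_p<p/6$ for all $0\le l\le k$ (there is at most one such $j$), and returns $0$ if no such $j$ exists. The median of a list of $n$ real numbers ($n$ is odd here) is its middle element after sorting. When the algorithm selects a given number of elements with largest absolute value, ties are broken arbitrarily, and if fewer elements than that number exist, all of them are selected. *)

(* Defs.v *)
From HB Require Import structures.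
From mathcomp Require Import all_boot all_order all_algebra all_fingroup.
From mathcomp Require Import all_classical all_reals all_analysis.
From mathcomp.real_closed Require Import complex.
Set Implicit Arguments.
Unset Strict Implicit.
Unset Printing Implicit Defensive.
Import Order.TTheory GRing.Theory Num.Theory.
Local Open Scope ring_scope.
Local Open Scope complex_scope.

Section Complex.
Variable R : realType.

(* e ^ (i t) *)
Definition expi (t : R) : R[i] := cos t +i* sin t.

Lemma expi0 : expi 0 = 1. Proof. by rewrite /expi cos0 sin0. Qed.

Lemma expiD s t : expi (s + t) = expi s * expi t.
Proof.
by rewrite /expi cosD sinD; congr (_ +i* _); rewrite addrC.
Qed.

Lemma expiX t k : expi t ^+ k = expi (t *+ k).
Proof.
by elim: k => [|k IHk]; rewrite ?mulr0n ?expi0 // exprS IHk mulrS expiD.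
Qed.

(* The principal argument of a nonzero complex number. *)
Definition arg (z : R[i]) : R :=
  xget 0 [set t | - pi < t <= pi /\ z = `|z| * expi t]%classic.

(* |x|_d, the distance from x to the set of integer multiples of d *)
Definition dist_mulz (d x : R) : R :=
  inf [set `|x - d * z%:~R| | z in [set: int]]%classic.

Definition median (s : seq R) : R :=
  nth 0 (sort <=%R s) (size s)./2.

(* s is a possible outcome, in an arbitrary order, of selecting N elements of
   T at which |F| is largest, or all of T when it has fewer than N elements. *)
Definition largest (T : finType) (N : nat) (F : T -> R[i]) (s : seq T) : Prop :=
  [/\ uniq s, size s = minn N #|T|
    & forall a b, a \in s -> b \notin s -> `|F b| <= `|F a|].

End Complex.

Section Characters.
Variables (R : realType) (p : nat).

Definition omega : R[i] := expi (2 * pi / p%:R).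

(* The exponent is computed in 'F_p and read back in {0, ..., p - 1}. *)
Definition chi r (y : 'rV['F_p]_r) : {ffun 'rV['F_p]_r -> R[i]} :=
  [ffun x : 'rV['F_p]_r => omega ^+ (\sum_i x 0 i * y 0 i : 'F_p)%R].

(* The dual group, as the finite type of the functions of the form chi_y.
   The proof that p is prime is a parameter because the functions chi_y do not
   form a group for composite p. *)
Definition dual r of prime p := seq_sub (codom (@chi r)).

Variables (r : nat) (pr : prime p).
Local Notation V := 'rV['F_p]_r.
Local Notation D := (dual r pr).

HB.instance Definition _ := SubType.copy D (seq_sub (codom (@chi r))).
HB.instance Definition _ := Finite.copy D (seq_sub (codom (@chi r))).

Definition dual_fun (a : D) : V -> R[i] := ssval a.
Coercion dual_fun : dual >-> Funclass.

Definition Chi (y : V) : D := SeqSub (codom_f (@chi r) y).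

Lemma dualP (a b : D) : a =1 b <-> a = b.
Proof. by split=> [ab|-> //]; apply/val_inj/ffunP. Qed.

Lemma dualE (a : D) : exists y, a = Chi y.
Proof. by have /codomP[y ay] := ssvalP a; exists y; apply: val_inj. Qed.

Lemma omegaX : omega ^+ p = 1.
Proof.
have p0 : p%:R != 0 :> R by rewrite pnatr_eq0 -lt0n prime_gt0.
rewrite expiX -[X in expi X]mulr_natr mulfVK // mulr_natl.
by rewrite /expi cos2pi sin2pi.
Qed.

Lemma omega_modn k : omega ^+ (k %% p) = omega ^+ k.
Proof.
by rewrite [in RHS](divn_eq k p) exprD mulnC exprM omegaX expr1n mul1r.
Qed.

Lemma omegaD (a b : 'F_p) : omega ^+ (a + b)%R = omega ^+ a * omega ^+ b.
Proof.
rewrite -exprD -[in RHS]omega_modn.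
by congr (_ ^+ (_ %% _)); exact: Fp_cast.
Qed.

Lemma ChiD (y z : V) x : Chi (y + z) x = Chi y x * Chi z x.
Proof.
rewrite /dual_fun /= !ffunE -omegaD -big_split /=.
by congr (_ ^+ nat_of_ord _); apply: eq_bigr => i _; rewrite !mxE mulrDr.
Qed.

Lemma Chi0 x : Chi 0 x = 1.
Proof.
rewrite /dual_fun /= ffunE big1 ?expr0 // => i _.
by rewrite !mxE mulr0.
Qed.

Lemma Chi_neq0 (a : D) x : a x != 0.
Proof.
have [y ->] := dualE a; apply/eqP => ay0.
by have := ChiD y (- y) x; rewrite subrr Chi0 ay0 mul0r => /eqP; rewrite oner_eq0.
Qed.

Lemma ChiN y x : Chi (- y) x = (Chi y x)^-1.
Proof.
apply: (mulIf (Chi_neq0 (Chi y) x)).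
by rewrite mulVf ?Chi_neq0 // -ChiD addNr Chi0.
Qed.

Fact dual_mul_subproof (a b : D) : [ffun x => a x * b x] \in codom (@chi r).
Proof.
have [[y ->] [z ->]] := (dualE a, dualE b).
by apply/codomP; exists (y + z); apply/ffunP => x; rewrite ffunE -ChiD.
Qed.

Fact dual_one_subproof : [ffun=> 1] \in codom (@chi r).
Proof.
by apply/codomP; exists 0; apply/ffunP => x; rewrite ffunE -(Chi0 x).
Qed.

Fact dual_inv_subproof (a : D) : [ffun x => (a x)^-1] \in codom (@chi r).
Proof.
have [y ->] := dualE a.
by apply/codomP; exists (- y); apply/ffunP => x; rewrite ffunE -ChiN.
Qed.

Definition dual_mul (a b : D) : D := SeqSub (dual_mul_subproof a b).
Definition dual_one : D := SeqSub dual_one_subproof.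
Definition dual_inv (a : D) : D := SeqSub (dual_inv_subproof a).

Fact dual_mulA : associative dual_mul.
Proof. by move=> a b c; apply/dualP => x; rewrite /dual_fun /= !ffunE /dual_fun /= !ffunE mulrA. Qed.

Fact dual_mul1 : left_id dual_one dual_mul.
Proof. by move=> a; apply/dualP => x; rewrite /dual_fun /= ffunE /dual_fun /= ffunE mul1r. Qed.

Fact dual_mulV : left_inverse dual_one dual_inv dual_mul.
Proof.
move=> a; apply/dualP => x.
by rewrite /dual_fun /= !ffunE /dual_fun /= ffunE mulVf // Chi_neq0.
Qed.

HB.instance Definition _ :=
  Finite_isGroup.Build D dual_mulA dual_mul1 dual_mulV.

Lemma dualME (a b : D) x : ((a * b)%g : D) x = a x * b x.
Proof. by rewrite {1}/dual_fun /= ffunE. Qed.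

Lemma dual1E x : (1%g : D) x = 1.
Proof. by rewrite /dual_fun /= ffunE. Qed.

Lemma dualVE (a : D) x : (a^-1%g : D) x = (a x)^-1.
Proof. by rewrite {1}/dual_fun /= ffunE. Qed.

Lemma dual_mulC (a b : D) : (a * b = b * a)%g.
Proof. by apply/dualP => x; rewrite !dualME mulrC. Qed.

Definition annihilator (H : {vspace V}) : {set D} :=
  [set a : D | [forall x in H, a x == 1]].

Lemma annihilatorP (H : {vspace V}) (a : D) :
  reflect {in H, forall x, a x = 1} (a \in annihilator H).
Proof.
by rewrite inE; apply: (iffP forall_inP) => aH x /aH; [move/eqP | move->].
Qed.

Fact annihilator_group_set H : group_set (annihilator H).
Proof.
apply/group_setP; split; first by apply/annihilatorP => x _; exact: dual1E.
move=> a b /annihilatorP aH /annihilatorP bH; apply/annihilatorP => x xH.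
by rewrite dualME aH // bH // mulr1.
Qed.
Canonical annihilator_group H := Group (annihilator_group_set H).

Definition fourier (f : V -> R[i]) (a : D) : R[i] :=
  (p%:R ^+ r)^-1 * \sum_x f x * (a x)^-1.

(* The Fourier transform for H, on the quotient of the dual group by the
   annihilator of H; it only depends on the values of u on H. *)
Definition fourier_sub (H : {vspace V}) (u : V -> R[i])
    (C : coset_of (annihilator H)) : R[i] :=
  #|H|%:R^-1 * \sum_(x in H) u x * ((repr C : D) x)^-1.

Lemma fourier_subE (H : {vspace V}) (u : V -> R[i]) (a : D) :
  fourier_sub u (coset (annihilator H) a)
    = #|H|%:R^-1 * \sum_(x in H) u x * (a x)^-1.
Proof.
have Na : a \in 'N(annihilator H)%g.
  by apply/normP/setP => b; rewrite mem_conjg conjgE dual_mulC invgK mulgKV.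
congr (_ * _); apply: eq_bigr => x xH; congr (_ * _^-1).
rewrite val_coset //=; case: repr_rcosetP => b /annihilatorP bH.
by rewrite dualME bH // mul1r.
Qed.

End Characters.

Definition l1norm (R : realType) (T : finType) (F : T -> R[i]) : R[i] :=
  \sum_a `|F a|.

Definition support_size (R : realType) (T : finType) (F : T -> R[i]) : nat :=
  #|[set a | F a != 0]|.

Definition generating p r n (m : nat) (H : 'I_n -> {vspace 'rV['F_p]_r}) : Prop :=
  forall I : {set 'I_n}, #|I| = m -> (\sum_(i in I) H i)%VS = fullv.

Section OneFrequency.
Variables (R : realType) (p : nat).

Fact top_scale_subproof : exists k, (p <= 3 * 2 ^ k)%N.
Proof.
by exists p; rewrite (leq_trans (ltnW (ltn_expl p (isT : 1 < 2)%N))) ?leq_pmull.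
Qed.

(* The least k with 2 ^ k >= p / 3; negative exponents need not be considered,
   since 2 ^ (-1) < p / 3 for p >= 2. *)
Definition top_scale : nat := ex_minn top_scale_subproof.

Variable u : 'F_p -> R[i].

Definition phase (l : nat) : R :=
  if (u (2 ^ l)%:R == 0) || (u 0 == 0) then 0 else arg (u (2 ^ l)%:R / u 0).

Definition one_frequency : 'F_p :=
  odflt 0 [pick j : 'F_p | [forall l : 'I_top_scale.+1,
    dist_mulz p%:R (p%:R * phase l / (2 * pi) - 2 ^+ l * (j : nat)%:R)
      < p%:R / 6]].

End OneFrequency.

Section Algorithm.
Variables (R : realType) (p r n t h : nat) (pr : prime p).
Local Notation V := 'rV['F_p]_r.
Local Notation D := (dual R r pr).
Variables (H : 'I_n -> {vspace V}) (x : 'I_n -> 'I_(r - h) -> V) (f : V -> R[i]).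
Local Notation cosets j := (coset_of (annihilator R pr (H j))).

Definition shifted_coef (j : 'I_n) (v : V) (C : cosets j) : R[i] :=
  fourier_sub (fun y => f (v + y)) C.

Definition found_freq (j : 'I_n) (C : cosets j) (l : 'I_(r - h)) : 'F_p :=
  one_frequency (fun a : 'F_p => shifted_coef (a *: x j l) C).

(* When the H j and x j l span V there is exactly one such w, and the default
   value is not used. *)
Definition found_char (j : 'I_n) (C : cosets j) : D :=
  odflt 1%g [pick w : D | (w \in (C : {set D})) &&
    [forall l, w (x j l) == omega R p ^+ found_freq C l]].

(* 2 t (ceil (r / h) - 1) + 1 *)
Definition vote_threshold : nat := (2 * t * ((r + h.-1) %/ h - 1) + 1)%N.

(* The state is the pair of the counters Y and of the list Z. *)
Definition vote (YZ : {ffun D -> nat} * seq D) (w : D) :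
    {ffun D -> nat} * seq D :=
  let Y := [ffun v => if v == w then (YZ.1 v).+1 else YZ.1 v] in
  (Y, if Y w == vote_threshold then rcons YZ.2 w else YZ.2).

(* S j lists the cosets processed for the index j, in order. *)
Definition candidates (S : forall j, seq (cosets j)) : seq D :=
  (foldl vote ([ffun=> 0%N], [::])
     [seq found_char C | j <- enum 'I_n, C <- S j]).2.

Definition median_estimate (S : forall j, seq (cosets j)) (w : D) : R[i] :=
  if w \in candidates S then
    let X := [seq shifted_coef 0 (coset (annihilator R pr (H j)) w)
             | j <- enum 'I_n] in
    median [seq complex.Re z | z <- X] +i* median [seq complex.Im z | z <- X]
  else 0.

(* fhat' is a possible output of the algorithm; the existential quantifiers
   range over all the ways to break ties and to order the selected elements. *)
Definition algorithm_returns (fhat' : D -> R[i]) : Prop :=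
  exists (S : forall j, seq (cosets j)) (T : seq D),
  [/\ forall j, largest (2 * t - 1) (shifted_coef 0 : cosets j -> R[i]) (S j),
      largest t (median_estimate S) T
    & forall w, fhat' w = if w \in T then median_estimate S w else 0].

End Algorithm.

(* Main.v *)
Require Import Defs.
From mathcomp Require Import all_boot all_order all_algebra all_fingroup.
From mathcomp Require Import all_classical all_reals all_analysis.
From mathcomp.real_closed Require Import complex.
From mathcomp Require Import ring lra zify.
Import Order.TTheory GRing.Theory Num.Theory.
Local Open Scope ring_scope.
Local Open Scope complex_scope.
Import Normc.

(** Write F for the Fourier transform of f, G for the support of ghat, E for
    the 1-norm of eps and d = E / t.  Averaging over the subspace H_j turns the
    spectrum of f into its sums over the cosets of the annihilator of H_j: by
    [shifted_coefE], the coefficient of a coset C for the shift v is the sum of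
    F(b) b(v) over the characters b in C.

    A nontrivial character annihilates fewer than m of the H_j, because any m
    of them span the whole space ([ann_few]).  Hence a fixed character a meets
    another element of G in its coset for at most t (m - 1) indices j, and, by
    Markov's inequality, the mass of eps on the rest of that coset exceeds d
    for at most t (m - 1) indices.  For the other indices, a is [isolated], and
    the coefficient of its coset is within d of F(a) a(v) ([isolated_coef]).
    Since n = 4 t (m - 1) + 1, the isolating indices form a strict majority
    ([isolated_many]).  This has two consequences.

    First, a median over all indices is within d of the truth in its real and
    in its imaginary part, so every estimate made by the algorithm is within
    sqrt 2 d of F(a) ([median_error]).

    Second, a character a with |F(a)| > 2 sqrt 2 d is always a candidate
    ([heavy_candidate]).  Let j isolate a.  The coefficient of the coset of a
    exceeds d, and at most 2t - 1 cosets have this property: at most t of them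
    meet G, and at most t - 1 of the others carry more than d of the mass of
    eps.  So the coset is selected.  The functions given to the one-frequency
    algorithm are pure waves F(a) omega^(ky) up to an error less than
    |F(a)| / sqrt 8; the phases then err by less than pi / 3, which identifies
    y ([one_frequency_correct]), and a is found.  The number of such j exceeds
    2t (m - 1), and m h >= r, so a gets enough votes.

    It remains to bound the loss in keeping only the t largest estimates
    ([select_error]).  Put c = sqrt 2 d and let T be the set of the characters
    kept.  An element of G outside T that is a candidate is charged to its
    own element of T outside G, whose estimate is at least as large; elements of
    G that are not candidates satisfy |F| <= 2c.  Each of the at most t elements
    of T then costs at most c, and each of the at most t elements of G at most
    2c, on top of the contribution of eps itself, which gives
    E + 3 c t = (1 + 3 sqrt 2) E. *)

Set Implicit Arguments.
Unset Strict Implicit.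
Unset Printing Implicit Defensive.

(** * Complex numbers and phases *)

Section Complex.
Variable R : realType.
Implicit Types (z w : R[i]) (s t : R).

(** Comparisons are made on [normc], which takes values in the totally ordered
    field R, whereas the norm of the normed structure on R[i] is a complex
    number. *)
Lemma norm_normc z : `|z| = (normc z)%:C.
Proof. by []. Qed.

Lemma normc_ge0 z : 0 <= normc z.
Proof. by case: z => a b; exact: sqrtr_ge0. Qed.

Lemma sqr_normc_ReIm z : normc z ^+ 2 = complex.Re z ^+ 2 + complex.Im z ^+ 2.
Proof. by case: z => a b /=; rewrite sqr_sqrtr // addr_ge0 ?sqr_ge0. Qed.

Lemma normc_gt0 z : (0 < normc z) = (z != 0).
Proof. by rewrite -ltcR -norm_normc normr_gt0. Qed.

Lemma normc_sum (I : finType) (P : pred I) (F : I -> R[i]) :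
  normc (\sum_(i | P i) F i) <= \sum_(i | P i) normc (F i).
Proof.
elim/big_ind2: _ => [|x1 x2 y1 y2 h1 h2|//]; first by rewrite normc0.
by rewrite (le_trans (le_normcD _ _)) // lerD.
Qed.

Lemma normc_expi t : normc (expi t) = 1.
Proof. by rewrite /= cos2Dsin2 sqrtr1. Qed.

Lemma expi_neq0 t : expi t != 0.
Proof. by rewrite -normc_gt0 normc_expi. Qed.

Lemma expi_2pi_int (k : int) : expi (2 * pi * k%:~R) = 1 :> R[i].
Proof.
have expi2pi : expi (2 * pi) = 1 :> R[i].
  by rewrite mulr_natl /expi cos2pi sin2pi.
case: k => k; first by rewrite -[k%:~R]/(k%:R) mulr_natr -expiX expi2pi expr1n.
apply: (mulIf (expi_neq0 (2 * pi * k.+1%:R))).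
rewrite NegzE mulrNz mulrN -expiD addNr expi0 mul1r.
by rewrite mulr_natr -expiX expi2pi expr1n.
Qed.

Lemma cos_neq1 t : 0 < t < 2 * pi -> cos t != 1.
Proof.
move=> /andP[t0 t2]; apply/eqP => c1.
have /sin_gt0_pi : 0 < t / 2 < pi.
  by rewrite divr_gt0 // ltr_pdivrMr // mulrC.
have := cos_mulr2n (t / 2); rewrite -[t / 2 *+ 2]mulr_natr mulfVK ?pnatr_eq0 // c1 => E.
have : sin (t / 2) ^+ 2 = 0 by rewrite sin2cos2; lra.
by move/eqP; rewrite sqrf_eq0 => /eqP->; rewrite ltxx.
Qed.

(** Subtracting from s - t the integer part in units of 2 pi leaves an angle in
    [0, 2 pi[ with cosine 1, which can only be 0. *)
Lemma expi_inj_mod s t : expi s = expi t ->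
  exists k : int, s - t = 2 * pi * k%:~R.
Proof.
move=> est; pose a := (s - t) / (2 * pi); exists (Num.floor a).
have pi2 : 0 < 2 * pi :> R by rewrite mulr_gt0 ?pi_gt0.
have [fa af] : (Num.floor a)%:~R <= a /\ a < (Num.floor a + 1)%:~R.
  by have /andP[] := floor_itv a.
have aE : s - t = 2 * pi * a by rewrite mulrC divfK // gt_eqF.
set k := Num.floor a in fa af *.
have e1 : expi (s - t - 2 * pi * k%:~R) = 1.
  have := expi_2pi_int (- k); rewrite mulrNz mulrN expiD => ->; rewrite mulr1.
  by apply: (mulIf (expi_neq0 t)); rewrite -expiD subrK mul1r.
apply/eqP; rewrite -subr_eq0; apply/contraT => d0.
have : cos (s - t - 2 * pi * k%:~R) != 1.
  apply: cos_neq1; rewrite lt_def d0 /= aE -mulrBr pmulr_rge0 // subr_ge0 fa.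
  by rewrite gtr_pMr // ltrBlDl; rewrite intrD in af.
by move/(congr1 (@complex.Re R)): e1 => /= ->; rewrite eqxx.
Qed.

Lemma arg_exists z : z != 0 -> exists t, - pi < t <= pi /\ z = `|z| * expi t.
Proof.
move=> z0; have n0 : 0 < normc z by rewrite normc_gt0.
have n1 : normc z != 0 by rewrite gt_eqF.
suff [t [tI tE]] : exists t, - pi < t <= pi /\ expi t = z / (normc z)%:C.
  exists t; split=> //; rewrite tE norm_normc mulrC divfK //.
  by apply: contra n1 => /eqP[->].
have -> : z / (normc z)%:C
    = (complex.Re z / normc z) +i* (complex.Im z / normc z).
  rewrite -fmorphV; case: {n0 n1}z z0 => a b _; apply/eqP; rewrite eq_complex /=.
  by rewrite !mulr0 subr0 add0r !eqxx.
set x := _ / _; set y := _ / _.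
have xy1 : x ^+ 2 + y ^+ 2 = 1.
  by rewrite !expr_div_n -mulrDl -sqr_normc_ReIm divff // expf_neq0.
have x1 : -1 <= x <= 1 by have := sqr_ge0 y => y2; apply/andP; split; nra.
have xI : x \in `[(-1), 1] by rewrite in_itv.
have sx : sin (acos x) = `|y|.
  by rewrite sin_acos // -sqrtr_sqr; congr Num.sqrt; rewrite -xy1; ring.
have [y0|y0] := leP 0 y.
  exists (acos x); rewrite acos_lepi // (lt_le_trans _ (acos_ge0 x1)); last first.
    by rewrite oppr_lt0 pi_gt0.
  by split=> //; rewrite /expi acosK // sx ger0_norm.
exists (- acos x); rewrite ltrN2 acos_ltpi; last first.
  case/andP: x1 => xge xle; rewrite xle andbT lt_neqAle xge andbT.
  by apply: contraTneq y0 => xN; rewrite -leNgt; move: xy1; rewrite -xN; nra.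
split; first by rewrite (le_trans _ (pi_ge0 _)) // oppr_le0 acos_ge0.
by rewrite /expi cosN sinN acosK // sx ltr0_norm // opprK.
Qed.

Lemma argP z : z != 0 -> - pi < arg z <= pi /\ z = (normc z)%:C * expi (arg z).
Proof. by move=> /arg_exists; exact: xgetPex. Qed.

(** The angles pi / 3 and 2 pi / 3 are supplementary, so c = cos (pi / 3)
    satisfies 2 c ^ 2 - 1 = - c by the duplication formula. *)
Lemma cos_pi3 : cos (pi / 3) = 1 / 2 :> R.
Proof.
set c := cos _.
have c0 : 0 < c.
  by apply: cos_gt0_pihalf; have := pi_gt0 R; lra.
have : cos (pi / 3 *+ 2) = - c.
  have -> : pi / 3 *+ 2 = - (pi / 3) + pi :> R by rewrite -mulr_natr; lra.
  by rewrite cosDpi cosN.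
by rewrite cos_mulr2n -/c => E; nra.
Qed.

Lemma angle_lt_pi3 t : - pi < t <= pi -> 1 / 2 < cos t -> `|t| < pi / 3.
Proof.
move=> /andP[t1 t2] ct; rewrite ltNge; apply/negP => pt.
have pi0 := pi_gt0 R.
have nt : `|t| <= pi by rewrite ler_norml t2 (ltW t1).
suff : cos `|t| <= cos (pi / 3) by rewrite cos_norm cos_pi3; lra.
rewrite leNgt; apply/negP; rewrite ltr_cos ?in_itv /=; first by lra.
- by rewrite nt normr_ge0.
- by apply/andP; split; lra.
Qed.

Lemma normc_lt_2Re z : 0 < complex.Re z ->
  complex.Im z ^+ 2 < 3 * complex.Re z ^+ 2 -> normc z < 2 * complex.Re z.
Proof.
move=> z0 zI; have n0 := normc_ge0 z; have n2 := sqr_normc_ReIm z.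
rewrite -ltr_sqr ?nnegrE //; first by rewrite n2 exprMn; lra.
by rewrite mulr_ge0 // ltW.
Qed.

(** The conclusion says that the ratio has argument less than pi / 3 in absolute
    value: both 1 + a and 1 + b have slopes y / x with 7 y ^ 2 <= x ^ 2, which
    is a consequence of the hypotheses by completing a square, and two such
    directions differ by less than pi / 3. *)
Lemma ratio_near1 (a b : R[i]) : 8 * normc a ^+ 2 < 1 -> 8 * normc b ^+ 2 < 1 ->
  [/\ 1 + a != 0, 1 + b != 0
    & normc ((1 + a) / (1 + b)) < 2 * complex.Re ((1 + a) / (1 + b))].
Proof.
have near1 (c : R[i]) : 8 * normc c ^+ 2 < 1 ->
    7 * complex.Im (1 + c) ^+ 2 <= complex.Re (1 + c) ^+ 2
    /\ 0 < complex.Re (1 + c).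
  rewrite sqr_normc_ReIm; case: c => x y /=; rewrite add0r => xy.
  (* the lines of slope +- 1 / sqrt 7 through -1 touch the circle
     8 |c| ^ 2 = 1 at points with real part - 1 / 8 *)
  by have := sqr_ge0 y; have := sqr_ge0 (8 * x + 1) => h1 h2; split; nra.
move=> /near1 + /near1; move: (1 + a) (1 + b) => {a b}[x y] [x' y'].
move=> [yx x0] [yx' x0']; rewrite /= in yx x0 yx' x0'; split.
- by apply: contraTneq x0 => -[-> _]; rewrite ltxx.
- by apply: contraTneq x0' => -[-> _]; rewrite ltxx.
have q0 : 0 < x' ^+ 2 + y' ^+ 2 by rewrite ltr_pwDl ?exprn_gt0 // sqr_ge0.
have -> : (x +i* y) / (x' +i* y') = ((x * x' + y * y') / (x' ^+ 2 + y' ^+ 2))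
    +i* ((y * x' - x * y') / (x' ^+ 2 + y' ^+ 2)).
  by apply/eqP; rewrite eq_complex /=; apply/andP; split; apply/eqP; field; rewrite gt_eqF.
have xx : 0 < x * x' by rewrite mulr_gt0.
have yy : 49 * (y * y') ^+ 2 <= (x * x') ^+ 2.
  have := ler_pM (mulr_ge0 (ler0n R 7) (sqr_ge0 y))
                 (mulr_ge0 (ler0n R 7) (sqr_ge0 y')) yx yx'.
  by rewrite !exprMn; lra.
have yyl : - (x * x') <= 7 * (y * y') by nra.
apply: normc_lt_2Re => /=; first by rewrite divr_gt0 //; lra.
rewrite !exprMn [3 * _]mulrA ltr_pM2r ?exprn_gt0 ?invr_gt0 //.
have h1 : 7 * (y * x') ^+ 2 <= (x * x') ^+ 2 by rewrite !exprMn; nra.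
have h2 : 7 * (x * y') ^+ 2 <= (x * x') ^+ 2 by rewrite !exprMn; nra.
have -> : (y * x' - x * y') ^+ 2 = (y * x') ^+ 2 + (x * y') ^+ 2
   - 2 * ((x * x') * (y * y')) by ring.
have -> : (x * x' + y * y') ^+ 2 = (x * x') ^+ 2 + (y * y') ^+ 2
   + 2 * ((x * x') * (y * y')) by ring.
have h3 : - (x * x') ^+ 2 <= 7 * ((x * x') * (y * y')).
  by have := ler_wpM2l (ltW xx) yyl; rewrite expr2; lra.
have := sqr_ge0 (y * y'); have : 0 < (x * x') ^+ 2 by rewrite exprn_gt0.
by lra.
Qed.

(** Noise of relative size less than 1 / sqrt 8 on both measurements of a wave
    perturbs the phase difference by less than pi / 3. *)
Lemma arg_ratio_close z (a b : R[i]) s : z != 0 ->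
  8 * normc a ^+ 2 < normc z ^+ 2 -> 8 * normc b ^+ 2 < normc z ^+ 2 ->
  [/\ z * expi s + a != 0, z + b != 0
    & exists k : int,
       `|arg ((z * expi s + a) / (z + b)) - s - 2 * pi * k%:~R| < pi / 3].
Proof.
move=> z0 az bz; have nz : 0 < normc z ^+ 2 by rewrite exprn_gt0 ?normc_gt0.
have es0 := expi_neq0 s.
have [] := @ratio_near1 (a / (z * expi s)) (b / z).
- rewrite normcM normcV normcM normc_expi mulr1 expr_div_n mulrA.
  by rewrite ltr_pdivrMr // mul1r.
- by rewrite normcM normcV expr_div_n mulrA ltr_pdivrMr // mul1r.
set A := 1 + _; set B := 1 + _ => A0 B0 AB.
have -> : z * expi s + a = z * expi s * A.
  by rewrite mulrDr mulr1 [_ * (a / _)]mulrC divfK // mulf_neq0.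
have -> : z + b = z * B by rewrite mulrDr mulr1 [_ * (b / _)]mulrC divfK.
rewrite !mulf_neq0 //; split=> //.
have -> : z * expi s * A / (z * B) = expi s * (A / B).
  by field; rewrite z0 B0.
have : A / B != 0 by rewrite mulf_neq0 ?invr_eq0.
move: (A / B) AB => w AB w0.
have [tI wE] := argP w0; have [_ ewE] := argP (mulf_neq0 es0 w0).
have [k kE] : exists k : int, arg (expi s * w) - (s + arg w) = 2 * pi * k%:~R.
  apply: expi_inj_mod; have nw0 : (normc w)%:C != 0.
    by rewrite -norm_normc normr_eq0.
  apply: (mulfI nw0); rewrite expiD (mulrCA (normc w)%:C (expi s)) -wE.
  by rewrite [RHS]ewE normcM normc_expi mul1r.
exists k; have -> : arg (expi s * w) - s - 2 * pi * k%:~R = arg w.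
  by rewrite -kE; ring.
apply: angle_lt_pi3 => //; have nw : 0 < normc w by rewrite normc_gt0.
have : complex.Re w = normc w * cos (arg w).
  by rewrite {1}wE /= mul0r subr0.
by move: AB; nra.
Qed.

Lemma normc_Re_le z : `|complex.Re z| <= normc z.
Proof.
rewrite -ler_sqr ?nnegrE ?normc_ge0 // sqr_normc_ReIm real_normK ?num_real //.
by rewrite lerDl sqr_ge0.
Qed.

Lemma normc_Im_le z : `|complex.Im z| <= normc z.
Proof.
rewrite -ler_sqr ?nnegrE ?normc_ge0 // sqr_normc_ReIm real_normK ?num_real //.
by rewrite lerDr sqr_ge0.
Qed.

Lemma normc_le_sqrt2 z d :
  `|complex.Re z| <= d -> `|complex.Im z| <= d -> normc z <= Num.sqrt 2 * d.
Proof.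
move=> zR zI; have d0 : 0 <= d := le_trans (normr_ge0 _) zR.
rewrite -ler_sqr ?nnegrE ?normc_ge0 ?mulr_ge0 ?sqrtr_ge0 //.
rewrite sqr_normc_ReIm exprMn sqr_sqrtr //.
rewrite -(real_normK (num_real (complex.Re z))) -(real_normK (num_real (complex.Im z))).
by rewrite mulr_natl mulr2n lerD // ler_sqr ?nnegrE.
Qed.

End Complex.

(** * The one-frequency algorithm *)

Section OneFrequency.
Variable R : realType.

Lemma dist_mulz_ltP (d x c : R) :
  dist_mulz d x < c <-> exists k : int, `|x - d * k%:~R| < c.
Proof.
split=> [/inf_lt[|y [k _ <-] yc]|[k kc]]; last 1 first.
- apply: le_lt_trans kc; apply: ge_inf; last by exists k.
  by exists 0 => y [l _ <-].
- by exists `|x - d * 0%:~R|; exists 0.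
- by exists k.
Qed.

Lemma int_norm_lt1 (k : int) : `|k%:~R : R| < 1 -> k = 0.
Proof.
rewrite -intr_norm -[1]/(1%:~R) ltr_int => k1; lia.
Qed.

(** If the multiples d, 2d, 4d, ..., 2 ^ K d are all within q / 3 of a multiple
    of q, the distance from d to the nearest multiple doubles at every step,
    since a number within 2q / 3 of one multiple and within q / 3 of another
    would put these two at distance less than q.  After K steps
    2 ^ K >= q / 3 forces the integer distance to be 0. *)
Lemma doubling_separates (d q : int) (K : nat) : 0 < q ->
  (q%:~R <= 3 * 2 ^+ K :> R) ->
  (forall l, (l <= K)%N ->
    exists k : int, `|2 ^+ l * d%:~R - q%:~R * k%:~R : R| < q%:~R / 3) ->
  exists k, d = q * k.
Proof.
move=> q0 qK near; have q0R : 0 < q%:~R :> R by rewrite ltr0z.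
have [k0] := near 0%N isT; rewrite expr0 mul1r => k0P.
suff dbl l : (l <= K)%N -> 2 ^+ l * `|d%:~R - q%:~R * k0%:~R : R| < q%:~R / 3.
  have := dbl K (leqnn _) => dK; exists k0; apply/eqP; rewrite -subr_eq0.
  apply/eqP/int_norm_lt1; rewrite intrD mulrNz intrM.
  have h : 0 < 2 ^+ K :> R by rewrite exprn_gt0.
  have := normr_ge0 (d%:~R - q%:~R * k0%:~R : R) => h'.
  by rewrite -(ltr_pM2l h) mulr1; lra.
elim: l => [|l IHl] lK; first by rewrite expr0 mul1r.
have {IHl} := IHl (ltnW lK); have [k] := near l.+1 lK; rewrite exprS.
have h : 0 <= 2 ^+ l :> R by rewrite exprn_ge0.
rewrite -[2 * _ * `|_|]mulrA -[X in X * `|_| < _](ger0_norm h) -[X in 2 * (X * _)](ger0_norm h) -normrM.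
set a := 2 ^+ l * (_ - _) => kP aP.
(* the multiple near 2 ^ l.+1 * d is the one inherited from step l *)
have k1 : k = (2 ^+ l.+1 * k0)%R.
  apply/eqP; rewrite -subr_eq0; apply/eqP/int_norm_lt1.
  rewrite -(ltr_pM2l q0R) mulr1 -{1}(gtr0_norm q0R) -normrM.
  have -> : q%:~R * (k - 2 ^+ l.+1 * k0)%:~R
      = 2 * a - (2 * 2 ^+ l * d%:~R - q%:~R * k%:~R) :> R.
    by rewrite /a intrD mulrNz intrM exprS intrM rmorphXn /=; ring.
  by rewrite (le_lt_trans (ler_normB _ _)) // normrM ger0_norm //; lra.
move: kP; rewrite k1 intrM exprS intrM rmorphXn /=.
have -> : 2 * 2 ^+ l * d%:~R - q%:~R * (2 * 2 ^+ l * k0%:~R) = 2 * a :> R.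
  by rewrite /a; ring.
by rewrite normrM ger0_norm.
Qed.

Variables (p : nat) (pr : prime p).

Let p0R : 0 < p%:R :> R. Proof. by rewrite ltr0n prime_gt0. Qed.

Lemma top_scaleP : p%:R <= 3 * 2 ^+ top_scale p :> R.
Proof.
rewrite /top_scale; case: ex_minnP => k pk _.
by rewrite -natrX -natrM ler_nat.
Qed.

Lemma Fp_lt (j : 'F_p) : (j < p)%N.
Proof. by rewrite -[X in (_ < X)%N](Fp_cast pr) ltn_ord. Qed.

(** Two admissible frequencies have a difference all of whose doublings are
    within p / 3 of a multiple of p, hence are equal. *)
Lemma one_frequency_unique (u : 'F_p -> R[i]) (y : 'F_p) :
  (forall l, (l <= top_scale p)%N ->
     dist_mulz p%:R (p%:R * phase u l / (2 * pi) - 2 ^+ l * (y : nat)%:R)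
       < p%:R / 6) ->
  one_frequency u = y.
Proof.
move=> yP; rewrite /one_frequency; case: pickP => [j /forallP jP|/(_ y)] /=; last first.
  by move/negP; case; apply/forallP => l; apply: yP; rewrite -ltnS.
have [k E] : exists k, (j : int) - (y : int) = p%:Z * k.
  apply: (@doubling_separates _ _ (top_scale p)); rewrite ?ltz_nat ?prime_gt0 //.
    exact: top_scaleP.
  move=> l lK; have /dist_mulz_ltP[k1 k1P] := yP l lK.
  have /dist_mulz_ltP[k2 k2P] := jP (Ordinal (lK : (l < (top_scale p).+1)%N)).
  exists (k1 - k2); move: k1P k2P; rewrite /= !intrB.
  set a := p%:R * _ / _ => k1P k2P.
  have -> : 2 ^+ l * ((j : int)%:~R - (y : int)%:~R) - p%:~R * (k1%:~R - k2%:~R)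
     = (a - 2 ^+ l * (y : nat)%:R - p%:R * k1%:~R)
       - (a - 2 ^+ l * (j : nat)%:R - p%:R * k2%:~R) :> R.
    by rewrite -!pmulrn; ring.
  by rewrite (le_lt_trans (ler_normB _ _)) // -!pmulrn; lra.
apply/val_inj/eqP => /=.
have jy : `|(j : int) - (y : int)| < p%:Z.
  by have := Fp_lt j; have := Fp_lt y; lia.
have k0 : k = 0.
  move: jy; rewrite E normrM -[X in _ < X]mulr1 ltr_pM2l; last by rewrite ltz_nat prime_gt0.
  by lia.
by move/eqP: E; rewrite k0 mulr0 subr_eq0.
Qed.

Lemma omega_phase k : omega R p ^+ k = expi (2 * pi * k%:R / p%:R).
Proof. by rewrite /omega expiX -[_ / _ *+ k]mulr_natr mulrAC. Qed.

(** An angular error of pi / 3 becomes p / 6 in units of 2 pi / p. *)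
Lemma one_frequency_correct (u : 'F_p -> R[i]) (z : R[i]) (y : 'F_p) :
  (forall a : 'F_p,
     8 * normc (u a - z * omega R p ^+ (a * y)%R) ^+ 2 < normc z ^+ 2) ->
  one_frequency u = y.
Proof.
move=> uP; apply: one_frequency_unique => l _.
have z0 : z != 0.
  rewrite -normc_gt0 lt_def normc_ge0 andbT -sqrf_eq0 gt_eqF //.
  by apply: le_lt_trans (uP 0); rewrite mulr_ge0 ?sqr_ge0.
pose s : R := 2 * pi * (2 ^ l * y)%:R / p%:R.
have sE : omega R p ^+ ((2 ^ l)%:R * y : 'F_p)%R = expi s.
  rewrite -omega_phase -[in RHS]omega_modn //; congr (_ ^+ _).
  by rewrite -[in LHS](natr_Zp y) -natrM val_Fp_nat.
have := uP (2 ^ l)%:R; rewrite sE; set a := _ - _ => aP.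
have := uP 0; rewrite mul0r expr0 mulr1; set b := _ - _ => bP.
have [] := @arg_ratio_close R z a b s z0 aP bP.
rewrite /a /b ![_ + (_ - _)]addrC !subrK => ul u0 [k kP].
rewrite /phase (negbTE ul) (negbTE u0) /=; apply/dist_mulz_ltP; exists k.
have pi0 := pi_gt0 R; have q0 : 0 < 2 * pi :> R by rewrite mulr_gt0.
set al := arg _ in kP *.
have -> : p%:R * al / (2 * pi) - 2 ^+ l * (y : nat)%:R - p%:R * k%:~R
    = p%:R / (2 * pi) * (al - s - 2 * pi * k%:~R).
  by rewrite /s natrM natrX; move: pi pi0 => q q1; field; rewrite !gt_eqF.
rewrite normrM ger0_norm ?divr_ge0 ?ltW //.
rewrite -ltr_pdivlMl ?divr_gt0 //; apply: lt_le_trans kP _.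
rewrite le_eqVlt; apply/orP; left; apply/eqP.
by move: pi pi0 => q q1; field; rewrite !gt_eqF.
Qed.

End OneFrequency.

(** * Medians *)

Section Median.
Variable R : realType.
Implicit Types (s : seq R) (b : R).

Lemma sorted_nth_le s i j : (i <= j < size s)%N ->
  nth 0 (sort <=%R s) i <= nth 0 (sort <=%R s) j.
Proof.
move=> /andP[ij js]; apply: (sorted_leq_nth le_trans lexx) => //.
- exact: sort_le_sorted.
- by rewrite inE size_sort (leq_ltn_trans ij).
- by rewrite inE size_sort.
Qed.

Lemma median_le s b : ((size s)./2 < count (<= b) s)%N -> median s <= b.
Proof.
set k := (size s)./2 => kc; rewrite leNgt; apply/negP => bm; move: kc.
have ks : (k <= size s)%N by rewrite /k; lia.
apply/negP; rewrite -leqNgt -(count_sort <=%R) -(cat_take_drop k (sort <=%R s)).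
rewrite count_cat [X in (_ + X)%N](_ : _ = 0%N) ?addn0.
  by rewrite (leq_trans (count_size _ _)) // size_take size_sort; case: ifP; lia.
apply/eqP; rewrite -leqn0 leqNgt -has_count -all_predC; apply/(all_nthP 0) => i.
rewrite size_drop size_sort => ik; rewrite nth_drop /= -ltNge.
by apply: lt_le_trans bm _; apply: sorted_nth_le; rewrite leq_addr -ltn_subRL.
Qed.

Lemma median_ge s b : odd (size s) ->
  ((size s)./2 < count (>= b) s)%N -> b <= median s.
Proof.
set k := (size s)./2 => so kc; rewrite leNgt; apply/negP => bm; move: kc.
have sE : size s = (k + k).+1 by rewrite /k; lia.
apply/negP; rewrite -leqNgt -(count_sort <=%R).
rewrite -(cat_take_drop k.+1 (sort <=%R s)) count_cat.
rewrite [X in (X + _)%N](_ : _ = 0%N) ?add0n.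
  by rewrite (leq_trans (count_size _ _)) // size_drop size_sort sE; lia.
apply/eqP; rewrite -leqn0 leqNgt -has_count -all_predC; apply/(all_nthP 0) => i.
rewrite size_take size_sort sE => ik; rewrite nth_take; last first.
  by move: ik; case: ifP; lia.
rewrite /= -ltNge.
by apply: le_lt_trans bm; apply: sorted_nth_le; rewrite -/k; move: ik; case: ifP; lia.
Qed.

(** Fewer than half of the entries lie on either side of the interval, so the
    middle one is inside. *)
Lemma median_close s (a d : R) : odd (size s) ->
  ((size s)./2 < count (fun v => `|v - a| <= d)%R s)%N -> `|median s - a| <= d.
Proof.
move=> so sc; rewrite ler_norml lerBlDr lerBrDr; apply/andP; split.
  apply: median_ge => //; apply: leq_trans sc _; apply: sub_count => v /=.
  by rewrite ler_norml lerBrDr => /andP[].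
apply: median_le => //; apply: leq_trans sc _; apply: sub_count => v /=.
by rewrite ler_norml lerBlDr => /andP[].
Qed.

End Median.

(** * Counting votes *)

Section Vote.
Variables (R : realType) (p r t h : nat) (pr : prime p).
Local Notation D := (dual R r pr).

(** The counter of w passes through the threshold exactly once, and Z records
    that passage. *)
Lemma vote_count (s : seq D) (w : D) :
  let YZ := foldl (@vote R p r t h pr) ([ffun=> 0%N], [::]) s in
  YZ.1 w = count_mem w s /\
  (w \in YZ.2) = (vote_threshold r t h <= count_mem w s)%N.
Proof.
have th0 : (0 < vote_threshold r t h)%N by rewrite /vote_threshold addn1.
elim/last_ind: s w => [|s v IHs] w /=.
  by rewrite ffunE in_nil; split=> //; rewrite leqNgt th0.
rewrite foldl_rcons -cats1 count_cat /= addn0.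
move: (IHs w) (IHs v) => /=; case: foldl => Y Z /= [Yw Zw] [Yv Zv].
rewrite /vote /= !ffunE eqxx Yv (eq_sym v w); split.
  by rewrite Yw; case: eqP => _; lia.
have [->|wv] := eqVneq w v.
  by case: ifP => vt; rewrite ?mem_rcons ?inE ?eqxx ?Zv /=; lia.
by case: ifP => vt; rewrite ?mem_rcons ?inE ?(negbTE wv) /= Zw addn0.
Qed.

(** Distinct indices cast distinct votes, and enough votes put w in the list by
    [vote_count]. *)
Lemma mem_candidates n (H : 'I_n -> {vspace 'rV['F_p]_r})
    (x : 'I_n -> 'I_(r - h) -> 'rV['F_p]_r) (f : 'rV['F_p]_r -> R[i])
    (S : forall j, seq (coset_of (annihilator R pr (H j)))) (w : D) :
  (vote_threshold r t h
     <= #|[set j | w \in [seq found_char x f C | C <- S j]]|)%N ->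
  w \in candidates t x f S.
Proof.
move=> le_t; have [_ ->] := vote_count [seq found_char x f C | j <- enum 'I_n, C <- S j] w.
apply: leq_trans le_t _; rewrite count_flatten sumnE !big_map -enumT big_enum /=.
rewrite -sum1_card big_mkcond /=; apply: leq_sum => j _.
by rewrite inE -has_pred1 has_count; case: ifP.
Qed.

End Vote.

(** * Keeping the largest estimates *)

Section Selection.
Variables (R : realType) (T : finType).

Lemma subset_card_exists (A : {set T}) k : (k <= #|A|)%N ->
  exists2 B : {set T}, B \subset A & #|B| = k.
Proof.
move=> kA; exists [set a in take k (enum A)].
  by apply/fintype.subsetP => a; rewrite inE => /mem_take; rewrite mem_enum.
rewrite cardsE (card_uniqP _) ?take_uniq ?enum_uniq // size_take -cardE.
by case: ltngtP kA.
Qed.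

(** All the values on A are bounded by their maximum, which is a lower bound
    of the values on B. *)
Lemma sum_le_sum_card (A B : {set T}) (u : T -> R) :
  #|A| = #|B| -> {in A & B, forall a b, u a <= u b} ->
  \sum_(a in A) u a <= \sum_(b in B) u b.
Proof.
move=> AB uAB; have [A0|[a0 a0A]] := set_0Vmem A.
  by move: AB; rewrite A0 cards0 => /esym/cards0_eq->; rewrite !big_set0.
case: (arg_maxP (P := mem A) u a0A) => a aA amax.
apply: (@le_trans _ _ (\sum_(b in A) u a)); first by apply: ler_sum => b /amax.
rewrite sumr_const AB -sumr_const; apply: ler_sum => b bB; exact: uAB.
Qed.

(** Here W is the vector of estimates of F, exact up to c on the set Z of
    candidates and 0 elsewhere; G is the set of significant indices, and e
    bounds F elsewhere.  An element of G missed by s while in Z costs at most c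
    plus its estimate; these estimates are dominated by those of equally many
    elements of s outside G, where the estimate is itself at most c + e. *)
Lemma select_error (t : nat) (F W : T -> R[i]) (e : T -> R) (G Z : {set T})
    (c : R) (s : seq T) :
  (#|G| <= t)%N -> 0 <= c -> (forall a, 0 <= e a) ->
  largest t W s ->
  (forall a, a \notin G -> normc (F a) <= e a) ->
  (forall a, a \notin Z -> W a = 0) ->
  (forall a, a \in Z -> normc (F a - W a) <= c) ->
  (forall a, a \in G -> a \notin Z -> normc (F a) <= 2 * c) ->
  \sum_a normc (F a - (if a \in s then W a else 0))
    <= \sum_a e a + 3 * c * t%:R.
Proof.
move=> Gt c0 e0 [us ss sW] FG WZ FWZ FGZ.
pose S := [set a in s]; pose A := (G :\: S) :&: Z.
have cS : #|S| = minn t #|T| by rewrite cardsE (card_uniqP us).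
have GS : (#|G :\: S| <= #|S :\: G|)%N.
  have [Tt|tT] := leqP #|T| t.
    have -> : G :\: S = finset.set0; last by rewrite cards0.
    have ST : S = [set: T].
      by apply/eqP; rewrite eqEcard finset.subsetT cardsT cS (minn_idPr Tt) /=.
    by rewrite ST finset.setDT.
  have := cardsID S G; have := cardsID G S; rewrite finset.setIC cS.
  by rewrite (minn_idPl (ltnW tT)); lia.
(* B holds the elements to which the missed candidates A are charged *)
have [B BS BA] : exists2 B : {set T}, B \subset S :\: G & #|B| = #|A|.
  apply: subset_card_exists; apply: leq_trans GS.
  by apply: subset_leq_card; apply: subsetIl.
have uAB : \sum_(a in A) normc (W a) <= \sum_(b in B) normc (W b).
  apply: sum_le_sum_card => // a b; rewrite !inE => /andP[/andP[aS _] _] bB.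
  have := fintype.subsetP BS b bB; rewrite !inE => /andP[_ bs].
  by have := sW b a bs aS; rewrite !norm_normc lecR.
pose ind (X : {set T}) a : R := (a \in X)%:R.
have iE X : \sum_a ind X a = #|X|%:R.
  by rewrite /ind -sumr_const; rewrite [RHS]big_mkcond; apply: eq_bigr => a _; case: (_ \in _).
have iM X (u : T -> R) : \sum_a ind X a * u a = \sum_(a in X) u a.
  rewrite [RHS]big_mkcond; apply: eq_bigr => a _.
  by rewrite /ind; case: (_ \in _); rewrite ?mul1r ?mul0r.
(* Written with indicators, the charging scheme is a pointwise inequality; the
   two terms in W compare after summation, by uAB. *)
have key a : normc (F a - (if a \in s then W a else 0)) + ind B a * normc (W a)
    <= e a + ind A a * normc (W a)
       + c * (ind S a + ind B a + ind (S :&: G) a + 2 * ind (G :\: S) a - ind A a).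
  have Bin : a \in B -> (a \in s) && (a \notin G).
    by move=> /(fintype.subsetP BS); rewrite !inE andbC.
  have := e0 a; have nW := normc_ge0 (W a).
  rewrite /ind !inE.
  have h1 : normc (F a) <= normc (F a - W a) + normc (W a).
    by rewrite -{1}(subrK (W a) (F a)); apply: le_normcD.
  have h2 : normc (W a) <= normc (F a - W a) + normc (F a).
    rewrite -[in X in X <= _](subKr (F a) (W a)) addrC.
    by apply: le_trans (le_normcD _ _) _; rewrite normcN.
  case aB: (a \in B).
    have /andP[as_ aG] := Bin aB; rewrite as_ (negbTE aG) /=.
    have := FG a aG; case aZ : (a \in Z).
      by have := FWZ a aZ; lra.
    by have := WZ a (negbT aZ) => ->; rewrite subr0 normc0; lra.
  case as_ : (a \in s); case aG : (a \in G); case aZ : (a \in Z) => /=;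
    rewrite ?subr0.
  - by have := FWZ a aZ; lra.
  - by have := FGZ a aG (negbT aZ); rewrite (WZ a (negbT aZ)) subr0 normc0; lra.
  - by have := FWZ a aZ; lra.
  - by have := FG a (negbT aG); rewrite (WZ a (negbT aZ)) subr0 normc0; lra.
  - by have := FWZ a aZ; lra.
  - by have := FGZ a aG (negbT aZ); lra.
  - by have := FG a (negbT aG); lra.
  - by have := FG a (negbT aG); lra.
have := @ler_sum _ _ (index_enum T) xpredT _ _ (fun a _ => key a).
rewrite !big_split /= -mulr_sumr sumrB !big_split /= -mulr_sumr !iE !iM BA.
have : #|S|%:R + #|S :&: G|%:R + 2 * #|G :\: S|%:R <= 3 * t%:R :> R.
  rewrite -!natrM -!natrD ler_nat; have := cardsID S G.
  by rewrite finset.setIC cS; have := geq_minl t #|T|; lia.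
by nra.
Qed.

End Selection.

(** * Fourier analysis on subspaces *)

Section Fourier.
Variables (R : realType) (p r : nat) (pr : prime p).
Local Notation V := 'rV['F_p]_r.
Local Notation D := (dual R r pr).
Implicit Types (a b : D) (x y v : V) (H : {vspace V}).

(** The pairing is symmetric, so what holds for a product of characters holds
    for a sum of points. *)
Lemma Chi_sym x y : Chi R pr x y = Chi R pr y x.
Proof.
rewrite /dual_fun /= !ffunE; congr (_ ^+ nat_of_ord _).
by apply: eq_bigr => i _; rewrite mulrC.
Qed.

Lemma dual0 a : a 0 = 1.
Proof. by have [y ->] := dualE a; rewrite Chi_sym Chi0. Qed.

Lemma dualD a x y : a (x + y) = a x * a y.
Proof. by have [z ->] := dualE a; rewrite !(Chi_sym z) ChiD. Qed.

Lemma dualN a x : a (- x) = (a x)^-1.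
Proof. by have [z ->] := dualE a; rewrite !(Chi_sym z) ChiN. Qed.

Lemma dualZ a (k : 'F_p) x : a (k *: x) = a x ^+ k.
Proof.
rewrite -[in LHS](natr_Zp k) scaler_nat.
by elim: (k : nat) => [|l IHl]; rewrite ?mulr0n ?dual0 // mulrS dualD IHl exprS.
Qed.

Lemma dual_omega a x : exists k : 'F_p, a x = omega R p ^+ k.
Proof. by have [z ->] := dualE a; rewrite /dual_fun /= ffunE; eexists. Qed.

Lemma normc_omegaX k : normc (omega R p ^+ k) = 1.
Proof. by rewrite /omega expiX normc_expi. Qed.

Lemma normc_dual a x : normc (a x) = 1.
Proof. by have [k ->] := dual_omega a x; exact: normc_omegaX. Qed.

Lemma omegaX_neq1 k : (0 < k < p)%N -> omega R p ^+ k != 1.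
Proof.
case/andP=> k0 kp; have p0 : 0 < p%:R :> R by rewrite ltr0n prime_gt0.
have pi0 := pi_gt0 R.
rewrite /omega expiX -[_ / _ *+ k]mulr_natr.
suff : cos (2 * pi / p%:R * k%:R) != 1 :> R.
  by apply: contraNneq => /(congr1 (@complex.Re R)) /= ->.
apply: cos_neq1; have kR : 0 < k%:R :> R by rewrite ltr0n.
rewrite mulr_gt0 ?divr_gt0 ?mulr_gt0 //=.
by rewrite -mulrA gtr_pMr ?mulr_gt0 // mulrC ltr_pdivrMr // mul1r ltr_nat.
Qed.

Lemma Chi_neq1 y : y != 0 -> exists x, Chi R pr y x != 1.
Proof.
case/rV0Pn=> i yi; exists (delta_mx 0 i).
rewrite /dual_fun /= ffunE (_ : (\sum_j _)%R = y 0 i); last first.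
  rewrite (bigD1 i) //= big1 ?addr0 => [|j ji]; first by rewrite mxE !eqxx mul1r.
  by rewrite mxE (negbTE ji) andbF mul0r.
apply: omegaX_neq1.
by rewrite lt0n -[X in (_ < X)%N](Fp_cast pr) ltn_ord andbT.
Qed.

Lemma Chi_inj : injective (@Chi R p r pr).
Proof.
move=> y z yz; apply/eqP; rewrite -subr_eq0; apply/contraT => /Chi_neq1[x].
by rewrite ChiD ChiN yz mulfV ?eqxx // Chi_neq0.
Qed.

(** If a x0 differs from 1 for some x0 in H, translation by x0 multiplies the
    sum by a x0. *)
Lemma sum_dual_subspace H a :
  \sum_(x in H) a x = if a \in annihilator R pr H then #|H|%:R else 0.
Proof.
case: ifPn => [/annihilatorP aH|].
  by rewrite -sumr_const; apply: eq_bigr.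
rewrite inE negb_forall => /existsP[x0]; rewrite negb_imply => /andP[x0H ax0].
apply/eqP; suff : (1 - a x0) * \sum_(x in H) a x == 0.
  by rewrite mulf_eq0 subr_eq0 eq_sym (negbTE ax0).
rewrite mulrBl mul1r subr_eq0 mulr_sumr; apply/eqP.
rewrite (reindex_inj (addrI x0)) /=.
by apply: eq_big => [x|x _]; rewrite ?rpredDl // dualD.
Qed.

Lemma card_rVp : #|{: V}| = (p ^ r)%N.
Proof. by rewrite card_mx mul1n card_Fp. Qed.

(** Exchanging the roles of points and characters, this is the orthogonality
    relation on the whole space. *)
Lemma sum_dual_at x : \sum_(a : D) a x = if x == 0 then p%:R ^+ r else 0.
Proof.
have [g gK] : exists g, cancel (@Chi R p r pr) g /\ cancel g (@Chi R p r pr).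
  have onto a : exists y, a == Chi R pr y.
    by have [y ->] := dualE a; exists y.
  exists (fun a => xchoose (onto a)); split=> [y|a].
    by apply: Chi_inj; apply/esym/eqP; exact: (xchooseP (onto _)).
  by apply/esym/eqP; exact: (xchooseP (onto _)).
rewrite (reindex (@Chi R p r pr)) /=; last first.
  by exists g => y _; [exact: gK.1|exact: gK.2].
rewrite (eq_bigr (Chi R pr x)) => [|y _]; last exact: Chi_sym.
have -> : \sum_y Chi R pr x y = \sum_(y in (fullv : {vspace V})) Chi R pr x y.
  by apply: eq_bigl => y; rewrite memvf.
rewrite sum_dual_subspace.
have -> : (Chi R pr x \in annihilator R pr fullv) = (x == 0).
  apply/annihilatorP/eqP => [xF|-> y _]; last exact: Chi0.
  apply/eqP; apply: contraT => /Chi_neq1[y]; rewrite xF ?eqxx //.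
  exact: memvf.
congr (if _ then _ else _); rewrite -natrX -card_rVp; congr _%:R.
by apply: eq_card => y; rewrite memvf.
Qed.

Lemma fourier_inversion (f : V -> R[i]) x :
  f x = \sum_(a : D) fourier f a * a x.
Proof.
under eq_bigr do rewrite /fourier -mulrA mulr_suml.
rewrite -mulr_sumr exchange_big /= (bigD1 x) //= [X in _ + X]big1 ?addr0.
  have -> : \sum_(a : D) f x / a x * a x = f x * \sum_(a : D) a 0.
    rewrite mulr_sumr; apply: eq_bigr => a _.
    by rewrite dual0 mulr1 mulfVK ?Chi_neq0.
  rewrite sum_dual_at eqxx mulrCA mulVf ?mulr1 //.
  by rewrite expf_neq0 // pnatr_eq0 -lt0n prime_gt0.
move=> z zx; under eq_bigr do rewrite -mulrA -dualN -dualD.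
by rewrite -mulr_sumr sum_dual_at addrC subr_eq0 eq_sym (negbTE zx) mulr0.
Qed.

Lemma coset_annE H a b :
  (b \in (coset (annihilator R pr H) a : {set D}))
    = ((b * a^-1)%g \in annihilator R pr H).
Proof.
rewrite val_coset ?mem_rcoset //=.
by apply/normP/setP => c; rewrite mem_conjg conjgE dual_mulC invgK mulgKV.
Qed.

(** Poisson summation: after Fourier inversion, orthogonality on H_j keeps the
    characters that agree with a on H_j. *)
Lemma shifted_coefE n (H : 'I_n -> {vspace V}) (f : V -> R[i]) j v a :
  shifted_coef f v (coset (annihilator R pr (H j)) a)
    = \sum_(b : D | (b * a^-1)%g \in annihilator R pr (H j)) fourier f b * b v.
Proof.
rewrite /shifted_coef fourier_subE.
under eq_bigr => y yH do rewrite (fourier_inversion f) mulr_suml.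
move: (fourier f) => F.
rewrite exchange_big /= mulr_sumr [RHS]big_mkcond /=; apply: eq_bigr => b _.
under eq_bigr => y _ do
  rewrite dualD -!mulrA -dualVE -dualME mulrA.
rewrite -mulr_sumr sum_dual_subspace; case: ifP => _; last by rewrite !mulr0.
rewrite mulrCA mulVf ?mulr1 // pnatr_eq0 -lt0n.
by apply/card_gt0P; exists 0; exact: mem0v.
Qed.

End Fourier.

(** * Characters trivial on a subspace *)

Section Vanishing.
Variables (R : realType) (p r : nat) (pr : prime p).
Local Notation V := 'rV['F_p]_r.
Local Notation D := (dual R r pr).
Implicit Types (a b : D).

Lemma dual_sum1 a (I : Type) (s : seq I) (P : pred I) (v : I -> V) :
  (forall i, P i -> a (v i) = 1) -> a (\sum_(i <- s | P i) v i) = 1.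
Proof.
move=> a1; apply: (big_ind (fun w => a w = 1)) => //; first exact: dual0.
by move=> w w' aw aw'; rewrite dualD aw aw' mulr1.
Qed.

Lemma dual_span1 a (X : seq V) :
  {in X, forall x, a x = 1} -> {in <<X>>%VS, forall v, a v = 1}.
Proof.
move=> aX v /(@coord_span _ _ _ (in_tuple X)) ->; apply: dual_sum1 => i _.
by rewrite dualZ aX ?expr1n // mem_nth.
Qed.

Lemma dual_full1 a : {in fullv, forall v, a v = 1} -> a = 1%g.
Proof. by move=> a1; apply/dualP => v; rewrite a1 ?memvf // dual1E. Qed.

Lemma coset_ann_eq H a b :
  (coset (annihilator R pr H) b == coset (annihilator R pr H) a)
    = ((b * a^-1)%g \in annihilator R pr H).
Proof.
apply/eqP/idP => [ba|]; last by rewrite -coset_annE => /coset_mem.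
by rewrite -coset_annE -ba coset_annE mulgV group1.
Qed.

(** A character trivial on m of the subspaces is trivial on their span. *)
Lemma ann_few n m (H : 'I_n -> {vspace V}) b : generating m H -> b != 1%g ->
  (#|[set j | b \in annihilator R pr (H j)]| < m)%N.
Proof.
move=> genH b1; rewrite ltnNge; apply/negP => /subset_card_exists[I IS Im].
case/negP: b1; apply/eqP/dual_full1 => v; rewrite -(genH I Im).
case/memv_sumP => vs vsH ->; apply: dual_sum1 => i iI.
by have := fintype.subsetP IS i iI; rewrite inE => /annihilatorP; apply; exact: vsH.
Qed.

End Vanishing.

(** * Recovery of the spectrum *)

Section Recovery.
Variables (R : realType) (p : nat) (pr : prime p) (r t m n : nat).
Hypothesis t_gt0 : (0 < t)%N.
Variable H : 'I_n -> {vspace 'rV['F_p]_r}.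
Hypothesis genH : generating m H.
Local Notation V := 'rV['F_p]_r.
Local Notation D := (dual R r pr).
Local Notation ann j := (annihilator R pr (H j)).
Variables (f : V -> R[i]) (ghat eps : D -> R[i]).
Hypothesis fhat_split : forall a : D, fourier f a = ghat a + eps a.
Hypothesis ghat_sparse : (support_size ghat <= t)%N.

Definition noise : R := \sum_a normc (eps a).
Definition tolerance : R := noise / t%:R.
Definition support : {set D} := [set a | ghat a != 0].

(** The condition under which the coefficient of the coset of a for H_j is a
    faithful measurement of the transform at a, see [isolated_coef]. *)
Definition isolated (j : 'I_n) (a : D) : bool :=
  [forall (b | (b != a) && ((b * a^-1)%g \in ann j)), b \notin support]
  && (\sum_(b | (b != a) && ((b * a^-1)%g \in ann j)) normc (eps b)
        <= tolerance).

Lemma noise_ge0 : 0 <= noise.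
Proof. by apply: sumr_ge0 => a _; exact: normc_ge0. Qed.

Lemma tolerance_ge0 : 0 <= tolerance.
Proof. by rewrite divr_ge0 ?noise_ge0. Qed.

Lemma toleranceM : tolerance * t%:R = noise.
Proof. by rewrite divfK // pnatr_eq0 -lt0n. Qed.

Lemma fhat_off_support a : a \notin support -> fourier f a = eps a.
Proof. by rewrite inE negbK fhat_split => /eqP->; rewrite add0r. Qed.

Lemma sum_noise_le (P : pred D) : \sum_(b | P b) normc (eps b) <= noise.
Proof.
rewrite /noise (bigID P xpredT) /= lerDl.
by apply: sumr_ge0 => a _; exact: normc_ge0.
Qed.

(** Markov's inequality.  It is strict when at least one value exceeds the
    tolerance, whence the predecessor. *)
Lemma card_above_tolerance (I : finType) (e : I -> R) k :
  (forall i, 0 <= e i) -> \sum_i e i <= k%:R * noise ->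
  (#|[set i | (tolerance < e i)%R]| <= (k * t).-1)%N.
Proof.
move=> e0 ek; rewrite leqNgt; apply/negP => ktN.
set L := [set i | _] in ktN; have [N0 ktN'] : (0 < #|L|)%N /\ (k * t <= #|L|)%N.
  by split; lia.
have : \sum_(i in L) tolerance < \sum_(i in L) e i.
  apply: ltr_sum => [|i]; last by rewrite inE.
  by case/card_gt0P: N0 => i iL; apply/hasP; exists i; rewrite ?mem_index_enum.
rewrite sumr_const -mulr_natl ltNge; apply/negP; rewrite negbK.
apply: (@le_trans _ _ (\sum_i e i)).
  by rewrite [leRHS](bigID (mem L)) /= lerDl; apply: sumr_ge0.
apply: le_trans ek _; rewrite -toleranceM mulrCA mulrC -natrM.
by rewrite ler_wpM2r ?tolerance_ge0 // ler_nat.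
Qed.

(** Both ways of failing to be isolated are counted by summing over b <> a the
    number of j for which b lies in the coset of a, which is at most m - 1. *)
Lemma isolated_many a : n = (4 * t * (m - 1) + 1)%N ->
  (2 * t * (m - 1) < #|[set j | isolated j a]|)%N.
Proof.
move=> nE.
pose e j := \sum_(b | (b != a) && ((b * a^-1)%g \in ann j)) normc (eps b).
pose bad1 := [set j | [exists (b | (b != a) && ((b * a^-1)%g \in ann j)), b \in support]].
pose bad2 := [set j | tolerance < e j].
have few b : b != a -> (#|[set j | (b * a^-1)%g \in ann j]| <= m - 1)%N.
  move=> ba; have := @ann_few R p r pr n m H (b * a^-1)%g genH.
  by rewrite -eq_mulgV1 => /(_ ba); move: #|_| => c; lia.
have cover : [set j | isolated j a] = ~: (bad1 :|: bad2).
  apply/setP => j; rewrite !inE /isolated negb_or -leNgt; congr (_ && _).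
  by rewrite negb_exists; apply: eq_forallb => b; rewrite negb_and implybE.
have b1 : (#|bad1| <= t * (m - 1))%N.
  apply: leq_trans (_ : \sum_(b in support :\ a) #|[set j | (b * a^-1)%g \in ann j]| <= _)%N.
    under eq_bigr do rewrite -sum1_card big_mkcond /=.
    rewrite exchange_big -sum1_card big_mkcond /=; apply: leq_sum => j _.
    case: ifP => //; rewrite inE => /existsP[b /andP[/andP[ba bj] bS]].
    have jb : j \in [set j0 | (b * a^-1)%g \in ann j0] by rewrite inE.
    by rewrite (bigD1 b) ?in_setD1 ?ba //= jb.
  apply: leq_trans (_ : \sum_(b in support :\ a) (m - 1) <= _)%N.
    by apply: leq_sum => b; rewrite !inE => /andP[/few].
  rewrite sum_nat_const leq_mul2r; apply/orP; right.
  by apply: leq_trans ghat_sparse; apply: subset_leq_card; exact: subsetDl.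
have b2 : (#|bad2| <= (m - 1) * t)%N.
  apply: leq_trans (leq_pred _); apply: card_above_tolerance => [j|].
    by apply: sumr_ge0 => b _; exact: normc_ge0.
  rewrite /e; under eq_bigr do rewrite big_mkcondr /=.
  rewrite exchange_big /=.
  apply: le_trans (_ : \sum_(b | b != a) (m - 1)%:R * normc (eps b) <= _).
    apply: ler_sum => b ba; rewrite -big_mkcond sumr_const -[leLHS]mulr_natl.
    rewrite ler_wpM2r ?normc_ge0 // ler_nat; apply: leq_trans (few b ba).
    by rewrite cardsE.
  by rewrite -mulr_sumr ler_wpM2l // sum_noise_le.
rewrite cover; have := cardsC (bad1 :|: bad2); rewrite card_ord.
have := (leq_card_setU bad1 bad2 : (_ <= _)%N).
move: #|_ :|: _| #|~: _| #|bad1| #|bad2| b1 b2 => c1 c2 c3 c4; move: nE; lia.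
Qed.

Lemma isolated_coef j a v : isolated j a ->
  normc (shifted_coef f v (coset (ann j) a) - fourier f a * a v) <= tolerance.
Proof.
move=> /andP[/forallP iso le_tol]; rewrite shifted_coefE (bigD1 a) ?mulgV ?group1 //=.
rewrite addrAC subrr add0r (eq_bigl _ _ (fun b => andbC _ _)).
apply: le_trans (normc_sum _ _) (le_trans _ le_tol); apply: ler_sum => b bP.
have := iso b; rewrite bP /= => /fhat_off_support->.
by rewrite normcM normc_dual mulr1.
Qed.

(** At most t cosets meet the support; the coefficient of any other coset is
    bounded by the mass of the noise on it, which exceeds noise / t for at most
    t - 1 disjoint cosets. *)
Lemma large_cosets_few j :
  (#|[set C : coset_of (ann j) | (tolerance < normc (shifted_coef f 0 C))%R]|
     <= 2 * t - 1)%N.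
Proof.
pose L2 := [set C : coset_of (ann j) | tolerance <
  \sum_(b | coset (ann j) b == C) normc (eps b)].
have cover : [set C : coset_of (ann j) | (tolerance < normc (shifted_coef f 0 C))%R]
    \subset [set coset (ann j) b | b in support] :|: L2.
  apply/fintype.subsetP => C; rewrite !inE => CT; apply/orP.
  have [CS|CS] := boolP (C \in _); [by left|right; apply: lt_le_trans CT _].
  have CE := coset_reprK C; rewrite -{1}CE shifted_coefE.
  apply: le_trans (normc_sum _ _) _; rewrite le_eqVlt; apply/orP; left; apply/eqP.
  apply: eq_big => b; rewrite -coset_ann_eq CE // => /eqP bC.
  rewrite dual0 mulr1 fhat_off_support //.
  by apply: contra CS => bS; apply/imsetP; exists b.
have L2t : (#|L2| <= (1 * t).-1)%N.
  apply: card_above_tolerance => [C|].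
    by apply: sumr_ge0 => b _; exact: normc_ge0.
  by rewrite mul1r /noise [leRHS](partition_big (coset (ann j)) xpredT).
apply: leq_trans (subset_leq_card cover) _.
apply: leq_trans (leq_card_setU _ _ : (_ <= _)%N) _.
have St : (#|[set coset (ann j) b | b in support]| <= t)%N.
  exact: leq_trans (leq_imset_card _ _) ghat_sparse.
by apply: leq_trans (leq_add St L2t) _; move: t_gt0; lia.
Qed.

(** Otherwise the selected cosets, all of whose coefficients are at least as
    large, would form with this one a set of more than 2t - 1 large cosets. *)
Lemma heavy_coset_selected j a (S : seq (coset_of (ann j))) :
  largest (2 * t - 1) (shifted_coef f 0 : coset_of (ann j) -> R[i]) S ->
  tolerance < normc (shifted_coef f 0 (coset (ann j) a)) ->
  coset (ann j) a \in S.
Proof.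
move=> [uS sS maxS] aT; apply/contraT => aS.
have : (#|coset (ann j) a |: [set C in S]| <= 2 * t - 1)%N.
  apply: leq_trans (large_cosets_few j); apply: subset_leq_card.
  apply/fintype.subsetP => C; rewrite !inE => /orP[/eqP->//|CS].
  by apply: lt_le_trans aT _; rewrite -lecR -!norm_normc maxS.
have := max_card (mem (coset (ann j) a |: [set C in S])).
rewrite cardsU1 inE aS cardsE (card_uniqP uS) sS; move: #|_| => N /=; lia.
Qed.

Section Algorithm.
Variables (h : nat) (x : 'I_n -> 'I_(r - h) -> V).
Hypothesis n_def : n = (4 * t * (m - 1) + 1)%N.

(** The isolating indices are a strict majority of the n = 4t(m - 1) + 1
    entries, so the medians of the real and imaginary parts inherit their
    accuracy. *)
Lemma median_error (S : forall j, seq (coset_of (ann j))) a : a \in candidates t x f S ->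
  normc (fourier f a - median_estimate t x f S a) <= Num.sqrt 2 * tolerance.
Proof.
move=> aZ; rewrite /median_estimate aZ.
pose X := [seq shifted_coef f 0 (coset (ann j) a) | j <- enum 'I_n].
rewrite -/X; have sX : size X = n by rewrite size_map size_enum_ord.
have med (P : R[i] -> R) : (forall z w, P (z - w) = P z - P w) ->
    (forall z, `|P z| <= normc z) ->
    `|median [seq P z | z <- X] - P (fourier f a)| <= tolerance.
  move=> PB Pn; apply: median_close; rewrite size_map sX.
    by rewrite n_def oddD !oddM.
  have -> : n./2 = (2 * t * (m - 1))%N by rewrite n_def; lia.
  apply: leq_trans (isolated_many a n_def) _.
  rewrite count_map /X count_map -size_filter.
  rewrite -(card_uniqP (filter_uniq _ (enum_uniq 'I_n))).
  apply: subset_leq_card; apply/fintype.subsetP => j; rewrite inE => iso.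
  rewrite mem_filter mem_enum andbT /= -PB; apply: le_trans (Pn _) _.
  by have := isolated_coef 0 iso; rewrite dual0 mulr1.
rewrite -[_ - _]opprB normcN; apply: normc_le_sqrt2.
  rewrite (_ : complex.Re _ = median [seq complex.Re z | z <- X] - complex.Re (fourier f a)).
    by apply: med => [[? ?] [? ?]|] //; exact: normc_Re_le.
  by case: (fourier f a).
rewrite (_ : complex.Im _ = median [seq complex.Im z | z <- X] - complex.Im (fourier f a)).
  by apply: med => [[? ?] [? ?]|] //; exact: normc_Im_le.
by case: (fourier f a).
Qed.

Hypothesis spanHx :
  forall j, (H j + <<[seq x j l | l <- enum 'I_(r - h)]>>)%VS = fullv.

(** Along a line k x_l, an isolated character produces the wave F(a) omega^(ky)
    up to the tolerance. *)
Lemma found_freq_isolated j a l (y : 'F_p) : isolated j a ->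
  8 * tolerance ^+ 2 < normc (fourier f a) ^+ 2 ->
  a (x j l) = omega R p ^+ y ->
  found_freq x f (coset (ann j) a) l = y.
Proof.
move=> iso heavy axy; apply: (@one_frequency_correct R p pr _ (fourier f a)) => k.
have -> : omega R p ^+ (k * y)%R = a (k *: x j l).
  rewrite dualZ axy -exprM mulnC -[RHS]omega_modn //.
  by congr (_ ^+ (_ %% _)); exact: Fp_cast.
apply: le_lt_trans heavy; rewrite ler_pM2l // ler_sqr ?nnegrE ?normc_ge0 ?tolerance_ge0 //.
exact: isolated_coef.
Qed.

(** Two characters in the same coset that agree on the x_l agree on a spanning
    set, so the choice made by the algorithm is forced. *)
Lemma found_char_isolated j a : isolated j a ->
  8 * tolerance ^+ 2 < normc (fourier f a) ^+ 2 ->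
  found_char x f (coset (ann j) a) = a.
Proof.
move=> iso heavy; rewrite /found_char.
have freq l : a (x j l) = omega R p ^+ found_freq x f (coset (ann j) a) l.
  have [y ay] := dual_omega a (x j l).
  by rewrite (found_freq_isolated iso heavy ay).
case: pickP => [w|/(_ a)] /=; last first.
  rewrite coset_annE mulgV group1 /= => /negP[].
  by apply/forallP => l; rewrite freq.
case/andP; rewrite coset_annE => /annihilatorP wH /forallP wx.
apply/eqP; rewrite eq_mulgV1; apply/eqP/dual_full1 => v; rewrite -(spanHx j).
case/memv_addP => v1 v1H [v2 v2x ->]; rewrite dualD wH // mul1r.
apply: dual_span1 v2x => _ /mapP[l _ ->].
by rewrite dualME dualVE (eqP (wx l)) freq mulfV // -freq Chi_neq0.
Qed.

Variable S : forall j, seq (coset_of (ann j)).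
Hypothesis S_largest : forall j,
  largest (2 * t - 1) (shifted_coef f 0 : coset_of (ann j) -> R[i]) (S j).
Hypothesis dimH : forall j, \dim (H j) = h.
Hypothesis h_gt0 : (0 < h)%N.
Hypothesis m_gt0 : (0 < m)%N.

(** Any m of the subspaces span; there are m of them because m <= n. *)
Lemma dim_le_generating : (r <= m * h)%N.
Proof.
have [I _ Im] : exists2 I : {set 'I_n}, I \subset [set: 'I_n] & #|I| = m.
  apply: subset_card_exists; rewrite cardsT card_ord n_def.
  by have : (m - 1 <= t * (m - 1))%N; [exact: leq_pmull|move: m_gt0; lia].
have := dimv_leq_sum (index_enum 'I_n) (mem I) H.
rewrite genH // dimvf /dim /= mul1n => /leq_trans; apply.
by rewrite (eq_bigr (fun=> h)) // sum_nat_const Im.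
Qed.

Lemma vote_threshold_le : (vote_threshold r t h <= 2 * t * (m - 1) + 1)%N.
Proof.
rewrite /vote_threshold leq_add2r leq_mul2l leq_sub2r ?orbT //.
rewrite -ltnS ltn_divLR // mulSn; have := dim_le_generating; lia.
Qed.

(** At an isolating index the coefficient of the coset of a still exceeds
    (2 sqrt 2 - 1) d >= d, and 8 d ^ 2 = (2 sqrt 2 d) ^ 2 is the noise level
    that the one-frequency algorithm tolerates. *)
Lemma heavy_candidate a : 2 * (Num.sqrt 2 * tolerance) < normc (fourier f a) ->
  a \in candidates t x f S.
Proof.
move=> heavy; apply: mem_candidates; apply: leq_trans vote_threshold_le _.
rewrite addn1; apply: leq_trans (isolated_many a n_def) _.
apply: subset_leq_card; apply/fintype.subsetP => j; rewrite !inE => iso.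
have s2 : Num.sqrt 2 ^+ 2 = 2 :> R by rewrite sqr_sqrtr.
have T0 := tolerance_ge0; have s0 : 0 <= Num.sqrt 2 :> R by exact: sqrtr_ge0.
have heavy2 : 8 * tolerance ^+ 2 < normc (fourier f a) ^+ 2.
  have -> : 8 * tolerance ^+ 2 = (2 * (Num.sqrt 2 * tolerance)) ^+ 2.
    by rewrite !exprMn s2; ring.
  have st0 : 0 <= 2 * (Num.sqrt 2 * tolerance) by do 2 apply: mulr_ge0 => //.
  by rewrite ltr_sqr ?nnegrE ?normc_ge0.
apply/mapP; exists (coset (ann j) a); last by rewrite found_char_isolated.
apply: heavy_coset_selected (S_largest j) _.
have := isolated_coef 0 iso; rewrite dual0 mulr1 => close.
have : normc (fourier f a) <= normc (shifted_coef f 0 (coset (ann j) a)) + tolerance.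
  rewrite -[in leLHS](subKr (shifted_coef f 0 (coset (ann j) a)) (fourier f a)).
  by apply: le_trans (le_normcD _ _) _; rewrite normcN lerD2l.
have : 1 <= Num.sqrt 2 :> R by nra.
nra.
Qed.

End Algorithm.

End Recovery.

(** * The error bound *)

Lemma l1norm_normc (R : realType) (T : finType) (F : T -> R[i]) :
  l1norm F = (\sum_a normc (F a))%:C.
Proof. by rewrite /l1norm rmorph_sum. Qed.

Theorem theorem12 (R : realType) (p : nat) (pr : prime p) (r t m h n : nat)
    (r_gt0 : (0 < r)%N) (t_gt0 : (0 < t)%N) (m_gt0 : (0 < m)%N)
    (h_bounds : (1 <= h <= r)%N) (n_def : n = (4 * t * (m - 1) + 1)%N)
    (H : 'I_n -> {vspace 'rV['F_p]_r})
    (dimH : forall j, \dim (H j) = h)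
    (genH : generating m H)
    (x : 'I_n -> 'I_(r - h) -> 'rV['F_p]_r)
    (spanHx : forall j, (H j + <<[seq x j l | l <- enum 'I_(r - h)]>>)%VS = fullv)
    (f : 'rV['F_p]_r -> R[i])
    (ghat eps : dual R r pr -> R[i])
    (fhat_split : forall a : dual R r pr, fourier f a = ghat a + eps a)
    (ghat_sparse : (support_size ghat <= t)%N)
    (fhat' : dual R r pr -> R[i])
    (fhat'_returned : algorithm_returns t H x f fhat') :
  (support_size fhat' <= t)%N /\
  l1norm (fun a : dual R r pr => fourier f a - fhat' a)
    <= (1 + 3 * Num.sqrt 2)%:C * l1norm eps.
Proof.
case: fhat'_returned => S [T [S_largest T_largest fhat'E]]; split.
  have [uT sT _] := T_largest.
  apply: leq_trans (geq_minl t #|{: dual R r pr}|); rewrite -sT -(card_uniqP uT).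
  apply: subset_leq_card; apply/fintype.subsetP => w; rewrite inE fhat'E.
  by case: ifP => //; rewrite eqxx.
have h_gt0 : (0 < h)%N by case/andP: h_bounds.
have tol0 := tolerance_ge0 t eps.
have s0 : 0 <= Num.sqrt 2 :> R by exact: sqrtr_ge0.
rewrite !l1norm_normc -rmorphM /= lecR.
under eq_bigr do rewrite fhat'E.
apply: le_trans (select_error (e := fun a => normc (eps a)) (G := support ghat)
  (Z := [set a in candidates t x f S]) (c := Num.sqrt 2 * tolerance t eps)
  ghat_sparse _ _ T_largest _ _ _ _) _.
- by rewrite mulr_ge0.
- by move=> a; exact: normc_ge0.
- by move=> a /(fhat_off_support fhat_split)->.
- by move=> a; rewrite inE /median_estimate => /negbTE->.
- by move=> a; rewrite inE => aZ; apply: (median_error t_gt0 genH fhat_split).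
- move=> a _; rewrite inE; apply: contraNT; rewrite -ltNge => heavy.
  exact: (heavy_candidate t_gt0 genH fhat_split).
rewrite -[X in _ + X]mulrA -[_ * tolerance t eps * _]mulrA toleranceM // -/(noise eps).
by move: (noise eps) (Num.sqrt 2) => N q; lra.
Qed.
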